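(* Let $K$ be a field, let $T=K[x_{11},\ldots,x_{1m_1},x_{21},\ldots,x_{2m_2},\ldots,x_{n1},\ldots,x_{nm_n}]$, and let $$I_{t}(\mathcal{K}'_{m_1,\dots,m_n})=\sum_{h=1}^{r}\prod_{i=1}^{n} L_{i,q_{h_i},2},\qquad q_{h_i}\geq 0,$$ be the generalized graph ideal of the strong quasi-$n$-partite graph $\mathcal{K}'_{m_1,\dots,m_n}$, where $\sum_{i=1}^{n}q_{h_i}=t$, $q_{h_i}\neq t$ and $0\leq q_{h_i}\leq 2m_i$ for all $i=1,\dots,n$ and $h=1,\dots,r$. Then for all $k\geq 1$, $$I_{t}(\mathcal{K}'_{m_1,\dots,m_n})^{k}=\sum_{\substack{k_1,\dots,k_r\geq 0\\ k_1+\cdots+k_r=k}}\ \prod_{i=1}^n\prod_{h=1}^r L_{i,q_{h_i},2}^{\,k_h}.$$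
   Context: $\mathcal{K}'_{m_1,\dots,m_n}$ denotes the strong quasi-$n$-partite graph (complete $n$-partite graph with a loop at every vertex) with vertex set $V=V_1\cup\cdots\cup V_n$, $V_i=\{x_{i1},\ldots,x_{im_i}\}$. For an integer $q\ge 0$ and $1\le i\le n$, $L_{i,q,2}\subset T$ is the Veronese type ideal generated by all monomials $x_{i1}^{a_{i1}}\cdots x_{im_i}^{a_{im_i}}$ with $\sum_{j=1}^{m_i}a_{ij}=q$ and $0\leq a_{ij}\leq 2$ for all $j$. The generalized graph ideal of $\mathcal{K}'_{m_1,\dots,m_n}$ in degree $t$ (generated by the degree-$t$ monomials corresponding to walks of length $t-1$) is given explicitly by $$I_{t}(\mathcal{K}'_{m_1,\dots,m_n})=\sum L_{1,q_{1},2}\cdots L_{n,q_{n},2},$$ the sum running over all $(q_1,\dots,q_n)$ of nonnegative integers with $\sum_{i=1}^n q_i=t$ and $q_i\neq t$ for all $i$. The index $h=1,\dots,r$ enumerates the tuples $(q_{h_1},\dots,q_{h_n})$ occurring in this sum (those with some $q_i>2m_i$ contribute the zero ideal). Zeroth powers of ideals are $T$. *)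

(* Defs.v *)
From mathcomp Require Import all_boot all_order all_algebra.
From mathcomp Require Import mpoly.

Set Implicit Arguments.
Unset Strict Implicit.
Unset Printing Implicit Defensive.

Import GRing.Theory.
Local Open Scope ring_scope.

Section Ideals.
Variable R : comNzRingType.

(* Ideals of R are represented by their membership predicates and compared
   extensionally.  Every operation below except idealT returns a generated
   ideal or an iterated product of such, hence an ideal. *)
Definition ideal := R -> Prop.

Definition eq_ideal (A B : ideal) : Prop := forall x, A x <-> B x.

Definition ideal_gen (S : R -> Prop) : ideal := fun x =>
  exists (l : nat) (c s : 'I_l -> R),
    (forall j, S (s j)) /\ x = \sum_(j < l) c j * s j.

Definition idealT : ideal := fun=> True.

Definition idealM (A B : ideal) : ideal :=
  ideal_gen (fun x => exists a b, [/\ A a, B b & x = a * b]).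

Definition idealX (A : ideal) (k : nat) : ideal :=
  \big[idealM/idealT]_(j < k) A.

(* The sum of the ideals F i over the indices i satisfying P, i.e. the ideal
   generated by their union; it is the zero ideal if there is no such index. *)
Definition ideal_sum (I : Type) (P : I -> Prop) (F : I -> ideal) : ideal :=
  ideal_gen (fun x => exists2 i, P i & F i x).

End Ideals.

Notation "A =I B" := (eq_ideal A B) (at level 70, no associativity).
Notation "\prodI_ ( i < n ) F" := (\big[@idealM _/@idealT _]_(i < n) F)
  (at level 36, F at level 36, i, n at level 50).

Section GraphIdeal.
Variables (K : fieldType) (n : nat) (m : 'I_n -> nat).

(* The pairs (i, j) indexing the variables x_ij. *)
Definition vertex := {i : 'I_n & 'I_(m i)}.

Definition polT := {mpoly K[#|{: vertex}|]}.

Definition var (i : 'I_n) (j : 'I_(m i)) : polT :=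
  'X_(enum_rank (Tagged (fun i => 'I_(m i)) j)).

(* L_{i,q,s}: the ideal of Veronese type, in the variables of V_i only. *)
Definition veronese (i : 'I_n) (q s : nat) : ideal polT :=
  ideal_gen (fun p => exists a : 'I_(m i) -> nat,
    [/\ (\sum_j a j)%N = q, forall j, (a j <= s)%N &
        p = \prod_j var j ^+ a j]).

(* The generalized graph ideal I_t of the strong quasi-n-partite graph on
   V_1, ..., V_n with |V_i| = m i, given by its explicit decomposition.  A
   tuple with q i > 2 * m i for some i contributes the zero ideal. *)
Definition gen_graph_ideal (t : nat) : ideal polT :=
  ideal_sum
    (fun q : 'I_n -> nat => (\sum_i q i)%N = t /\ forall i, q i <> t)
    (fun q => \prodI_(i < n) veronese i (q i) 2).

End GraphIdeal.

Arguments veronese K {n} m i q s.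
Arguments gen_graph_ideal K {n} m t.

(* Main.v *)
Require Import Defs.
From mathcomp Require Import all_boot all_order all_algebra.
From mathcomp Require Import mpoly.

(** Both sides are ideals with explicit generators, and the generators coincide.

    Sums and products of generated ideals are generated by the unions and the
    products of the generating sets ([ideal_sum_gen], [prodI_gen]).  Fix for
    each tuple [q h] and each block [i] the set [M h i] of Veronese monomials
    of degree [q h i].  The tuples having an entry above [2 * m i] produce no
    generator, as a monomial with exponents at most 2 has degree at most
    [2 * m i]; so the graph ideal is generated by the products over [i] of
    elements of [M h i], for [h] ranging over the enumerated tuples.

    A generator of the [k]-th power is then a product of [k] such elements, the
    [j]-th one being attached to an index [c j], while a generator on the right
    is a product in which [e h] factors are attached to [h], with the [e h]
    adding up to [k].  To pass from the former to the latter, group the [j] by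
    the value of [c], so that [e h] is the size of the fibre of [c] over [h];
    to go back, list the [k] pairs formed by an index [h] and a position below
    [e h].  Commutativity does the rest: this is [power_of_union]. *)

Set Implicit Arguments.
Unset Strict Implicit.
Unset Printing Implicit Defensive.

Import GRing.Theory.
Local Open Scope ring_scope.

(** * Generated ideals *)

Section GeneratedIdeals.
Variable R : comNzRingType.
Implicit Types S : R -> Prop.

Lemma ideal_gen0 S : ideal_gen S 0.
Proof.
exists 0%N, (fun=> 0), (fun=> 0).
by split; [case | rewrite big_ord0].
Qed.

Lemma mem_ideal_gen S x : S x -> ideal_gen S x.
Proof.
move=> Sx; exists 1%N, (fun=> 1), (fun=> x).
by split=> //; rewrite big_ord1 mul1r.
Qed.

Lemma ideal_genD S x y : ideal_gen S x -> ideal_gen S y -> ideal_gen S (x + y).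
Proof.
move=> [l [c [s [Ss ->]]]] [l' [c' [s' [Ss' ->]]]].
pose pick f f' (j : 'I_(l + l')) : R :=
  match split j with inl u => f u | inr u => f' u end.
exists (l + l')%N, (pick c c'), (pick s s'); split.
  by move=> j; rewrite /pick; case: (split j).
rewrite big_split_ord /=; congr (_ + _); apply: eq_bigr => j _.
  by rewrite /pick (unsplitK (inl j)).
by rewrite /pick (unsplitK (inr j)).
Qed.

Lemma ideal_genMl S c x : ideal_gen S x -> ideal_gen S (c * x).
Proof.
move=> [l [d [s [Ss ->]]]].
exists l, (fun j => c * d j), s; split=> //.
by rewrite mulr_sumr; apply: eq_bigr => j _; rewrite mulrA.
Qed.

Lemma ideal_gen_sum S l (f : 'I_l -> R) :
  (forall j, ideal_gen S (f j)) -> ideal_gen S (\sum_(j < l) f j).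
Proof.
move=> Sf; apply: (big_ind (ideal_gen S)) => //; first exact: ideal_gen0.
exact: ideal_genD.
Qed.

Lemma ideal_gen_sub S S' :
  (forall x, S x -> ideal_gen S' x) ->
  forall x, ideal_gen S x -> ideal_gen S' x.
Proof.
move=> sSS' _ [l [c [s [Ss ->]]]]; apply: ideal_gen_sum => j.
by apply: ideal_genMl; apply: sSS'.
Qed.

Lemma eq_ideal_gen S S' :
  (forall x, S x <-> S' x) -> ideal_gen S =I ideal_gen S'.
Proof.
by move=> eqS x; split; apply: ideal_gen_sub => y /eqS; apply: mem_ideal_gen.
Qed.

Lemma idealM_gen (A B : ideal R) S S' :
    A =I ideal_gen S -> B =I ideal_gen S' ->
  idealM A B =I
  ideal_gen (fun x => exists a b, [/\ S a, S' b & x = a * b]).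
Proof.
move=> eqA eqB x; split; apply: ideal_gen_sub => {x} _ [a [b [Aa Bb ->]]].
  have /eqA[l [c [s [Ss ->]]]] := Aa; have /eqB[l' [c' [s' [Ss' ->]]]] := Bb.
  rewrite mulr_suml; apply: ideal_gen_sum => i.
  rewrite mulr_sumr; apply: ideal_gen_sum => j.
  rewrite mulrACA; apply: ideal_genMl; apply: mem_ideal_gen.
  by exists (s i), (s' j).
apply: mem_ideal_gen; exists a, b; split=> //.
  by apply/eqA; apply: mem_ideal_gen.
by apply/eqB; apply: mem_ideal_gen.
Qed.

Lemma ideal_sum_gen (I : Type) (P : I -> Prop) (F : I -> ideal R)
    (S : I -> R -> Prop) :
    (forall i, F i =I ideal_gen (S i)) ->
  ideal_sum P F =I ideal_gen (fun x => exists2 i, P i & S i x).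
Proof.
move=> eqF x; split; apply: ideal_gen_sub => {}x [i Pi].
  move/eqF; apply: ideal_gen_sub => y Sy.
  by apply: mem_ideal_gen; exists i.
move=> Sx; apply: mem_ideal_gen; exists i => //.
by apply/eqF; apply: mem_ideal_gen.
Qed.

Definition set_prod l (S : 'I_l -> R -> Prop) (x : R) : Prop :=
  exists2 a : 'I_l -> R, forall i, S i (a i) & x = \prod_(i < l) a i.

(** The factors are generated ideals, so the empty product, which is the whole
    ring, matches the ideal generated by the empty product 1. *)
Lemma prodI_gen l (A : 'I_l -> ideal R) (S : 'I_l -> R -> Prop) :
    (forall i, A i =I ideal_gen (S i)) ->
  \prodI_(i < l) A i =I ideal_gen (set_prod S).
Proof.
elim: l A S => [|l IHl] A S eqA x.
  rewrite big_ord0; split=> // _.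
  rewrite -[x]mulr1; apply: ideal_genMl; apply: mem_ideal_gen.
  by exists (fun=> 0); [case | rewrite big_ord0].
rewrite big_ord_recl.
have /(idealM_gen (eqA ord0)) eqM :=
  IHl _ (fun i => S (lift ord0 i)) (fun i => eqA (lift ord0 i)).
apply: iff_trans (eqM x) _; apply: eq_ideal_gen => {eqM}x; split.
  move=> [a [_ [Sa [b Sb ->] ->]]].
  exists (fun i => if unlift ord0 i is Some j then b j else a).
    by move=> i; case: unliftP => [j|] ->.
  rewrite big_ord_recl unlift_none; congr (_ * _).
  by apply: eq_bigr => j _; rewrite liftK.
move=> [a Sa ->]; exists (a ord0), (\prod_(i < l) a (lift ord0 i)).
by split=> //; [exists (fun i => a (lift ord0 i)) | rewrite big_ord_recl].
Qed.

(** * Powers of a union of products *)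

(** The distributive law behind the theorem, read on generators: here [e h]
    counts the factors taken from the [h]-th set, and only these counts matter
    because multiplication is commutative.  No multinomial coefficient appears,
    since both sides are sets of products. *)
Lemma power_of_union r n (M : 'I_r -> 'I_n -> R -> Prop) k x :
  set_prod (fun _ : 'I_k => fun y => exists h, set_prod (M h) y) x <->
  exists2 e : 'I_r -> nat, (\sum_(h < r) e h)%N = k &
    set_prod (fun i : 'I_n => set_prod (fun h : 'I_r =>
      set_prod (fun _ : 'I_(e h) => M h i))) x.
Proof.
split.
  (* The j-th factor lies in the c j-th set; group the j by fibres of c. *)
  move=> [y /fin_all_exists[c yP] ->].
  have{yP} /fin_all_exists[a aP] : forall j, exists a : 'I_n -> R,
      (forall i, M (c j) i (a i)) /\ y j = \prod_(i < n) a i.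
    by move=> j; have [a Ma ya] := yP j; exists a.
  exists (fun h => #|[pred j | c j == h]|).
    rewrite -[RHS]card_ord -sum1_card (partition_big c predT) //=.
    by apply: eq_bigr => h _; rewrite -sum1_card.
  exists (fun i => \prod_(j < k) a j i); last first.
    by rewrite exchange_big; apply: eq_bigr => j _; have [] := aP j.
  move=> i; exists (fun h => \prod_(j | c j == h) a j i); last first.
    by rewrite (partition_big c predT).
  move=> h; exists (fun l => a (enum_val l) i); last first.
    exact: (big_enum_val (A := [pred j | c j == h]) (fun j => a j i)).
  move=> l; have /eqP c_l : c (enum_val l) == h by exact: (enum_valP l).
  by have [/(_ i)] := aP (enum_val l); rewrite c_l.
move=> [e sum_e [y yP ->]].
have /fin_all_exists[z zP] : forall i, exists z : 'I_r -> R,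
    (forall h, set_prod (fun _ : 'I_(e h) => M h i) (z h)) /\
    y i = \prod_(h < r) z h.
  by move=> i; have [z zP yz] := yP i; exists z.
have /fin_all_exists[b bP] : forall i, exists b : forall h, 'I_(e h) -> R,
    forall h, (forall l, M h i (b h l)) /\ z i h = \prod_(l < e h) b h l.
  move=> i.
  have /fin_all_exists[b bP] : forall h, exists bh : 'I_(e h) -> R,
      (forall l, M h i (bh l)) /\ z i h = \prod_(l < e h) bh l.
    by move=> h; have [bh Mbh zbh] := (zP i).1 h; exists bh.
  by exists b.
(* A factor on the right is named by an index and a position; since the e h
   add up to k, the k factors of the power can be matched with these names. *)
pose pos := {h : 'I_r & 'I_(e h)}.
have card_pos : k = #|{: pos}|.
  rewrite card_tagged sumnE big_map big_enum /= -sum_e.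
  by apply: eq_bigr => h _; rewrite card_ord.
pose p (j : 'I_k) : pos := enum_val (cast_ord card_pos j).
have p_bij : bijective p.
  apply: bij_comp; first exact: enum_val_bij.
  by exists (cast_ord (esym card_pos)) => u; rewrite ?cast_ordK ?cast_ordKV.
exists (fun j => \prod_(i < n) b i (tag (p j)) (tagged (p j))).
  move=> j; exists (tag (p j)), (fun i => b i (tag (p j)) (tagged (p j))) => //.
  by move=> i; have [] := bP i (tag (p j)).
rewrite exchange_big; apply: eq_bigr => i _ /=.
rewrite (zP i).2 -(reindex p (P := xpredT)
  (F := fun u : pos => b i (tag u) (tagged u))) /=; last exact: onW_bij.
rewrite -(sig_big_dep (I := 'I_r) (J := fun h => 'I_(e h)) xpredT
  (fun=> xpredT) (fun h l => b i h l)) /=.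
by apply: eq_bigr => h _; have [] := bP i h.
Qed.

End GeneratedIdeals.

(** * Veronese monomials *)

(** With this form of the predicate, [veronese] is by conversion the ideal
    generated by the Veronese monomials. *)
Definition veronese_monomial (K : fieldType) n (m : 'I_n -> nat) (i : 'I_n)
    (q s : nat) (p : polT K m) : Prop :=
  exists a : 'I_(m i) -> nat,
    [/\ (\sum_j a j)%N = q, forall j, (a j <= s)%N &
        p = \prod_j var K j ^+ a j].

Lemma veronese_monomial_deg (K : fieldType) n (m : 'I_n -> nat) (i : 'I_n) q s
    (p : polT K m) :
  veronese_monomial i q s p -> (q <= s * m i)%N.
Proof.
move=> [a [<- le_as _]]; apply: (@leq_trans (\sum_(j < m i) s)%N).
  exact: leq_sum.
by rewrite sum_nat_const card_ord mulnC.
Qed.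

Local Close Scope ring_scope.

Theorem proposition2p11 (K : fieldType) (n : nat) (m : 'I_n -> nat) (t : nat)
    (r : nat) (q : 'I_r -> 'I_n -> nat)
    (q_inj : forall h h' : 'I_r, q h =1 q h' -> h = h')
    (q_enum : forall s : 'I_n -> nat,
      (exists h : 'I_r, q h =1 s) <->
      [/\ \sum_(i < n) s i = t, forall i, s i <> t &
          forall i, s i <= 2 * m i])
    (k : nat) (k_ge1 : 1 <= k) :
  idealX (gen_graph_ideal K m t) k =I
  ideal_sum (fun e : 'I_r -> nat => \sum_(h < r) e h = k)
    (fun e => \prodI_(i < n) \prodI_(h < r)
                idealX (veronese K m i (q h i) 2) (e h)).
Proof.
pose M h i : polT K m -> Prop := veronese_monomial i (q h i) 2.
have graph_gen : gen_graph_ideal K m t =I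
    ideal_gen (fun x => exists h, set_prod (M h) x).
  move=> x; apply: (iff_trans (ideal_sum_gen _ (S := fun s : 'I_n -> nat =>
    set_prod (fun i => @veronese_monomial K n m i (s i) 2)) _ x)).
    by move=> s; apply: prodI_gen => i.
  apply: eq_ideal_gen => {}x; split.
    (* A tuple is enumerated as soon as it contributes a monomial. *)
    move=> [s [sum_s s_neq] [a Ma ->]].
    have [h qh] : exists h, q h =1 s.
      by apply/q_enum; split=> // i; apply: veronese_monomial_deg (Ma i).
    by exists h, a => // i; rewrite /M qh.
  move=> [h Mx]; have [|sum_q q_neq _] := (q_enum (q h)).1; first by exists h.
  by exists (q h).
move=> x; apply: (iff_trans (prodI_gen (fun=> graph_gen) x)).
apply: (iff_trans (eq_ideal_gen (power_of_union M k) x)).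
apply: iff_sym; apply: ideal_sum_gen => e.
apply: prodI_gen => i; apply: prodI_gen => h; apply: prodI_gen => _.
by [].
Qed.
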